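(* Let $\mu$ be a typical weight, i.e. $\lim_{|v|\to\infty}\mu(v) = 0$. Let $\psi: T \to \mathbb{C}$ be a function and $\varphi: T \to T$ a self-map with infinite range (i.e. $\varphi(T)$ is infinite). Then $W_{\psi,\varphi}$ is bounded on $L_\mu^0$ if and only if $\psi \in L_\mu^0$ and $$\sup_{v \in T} \frac{\mu(v)}{\mu(\varphi(v))}|\psi(v)| < \infty.$$
   Context: $(T,\mathrm{d})$ is a metric space with a distinguished point $o$ (the root); the length of $v \in T$ is $|v| = \mathrm{d}(o,v)$. $T$ is assumed locally finite (for every $M>0$ the set $\{v \in T : |v| < M\}$ is finite) and unbounded (for every $M>0$ there is $v \in T$ with $|v| \ge M$). $\mu: T \to (0,\infty)$ is a positive function (a weight). $L_\mu^\infty$ is the Banach space of functions $f: T \to \mathbb{C}$ with $\|f\|_\mu = \sup_{v \in T} \mu(v)|f(v)| < \infty$, and $L_\mu^0$ is its closed subspace of those $f$ with $\lim_{|v|\to\infty} \mu(v)|f(v)| = 0$. The weighted composition operator is the linear map $W_{\psi,\varphi} f = \psi\,(f\circ\varphi)$; it is bounded on $L_\mu^0$ if it is a bounded operator from $L_\mu^0$ to itself. *)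

(* Defs.v *)
From mathcomp Require Import all_boot all_order all_algebra.
From mathcomp Require Import all_classical all_reals all_analysis.
From mathcomp Require Export complex.
Set Implicit Arguments.
Unset Strict Implicit.
Unset Printing Implicit Defensive.
Import Order.TTheory GRing.Theory Num.Theory.
Import numFieldNormedType.Exports.
Local Open Scope classical_set_scope.
Local Open Scope ring_scope.

(* The modulus of a complex number as a real number; the norm [`|z|] of the
   numeric field [R[i]] is itself an element of [R[i]]. *)
Notation cmod := ComplexField.Normc.normc.

Section WeightedSpaces.
Context {R : realType} {T : metricType R}.
Implicit Types (o v : T) (mu : T -> R) (psi f g : T -> R[i]) (phi : T -> T).

Definition len o v : R := mdist o v.

Definition locally_finite o :=
  forall M : R, 0 < M -> finite_set [set v | len o v < M].

Definition unbounded o := forall M : R, 0 < M -> exists v, M <= len o v.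

(* The filter "|v| -> oo", generated by the sets {v | M < |v|}. *)
Definition len_infty o : set_system T :=
  filter_from [set: R] (fun M => [set v | M < len o v]).

Global Instance len_infty_filter o : Filter (len_infty o).
Proof.
apply: filter_from_filter => [|M N _ _]; first by exists 0.
exists (Num.max M N) => // v /=.
by rewrite gt_max => /andP[].
Qed.

Lemma len_infty_proper o : unbounded o -> ProperFilter (len_infty o).
Proof.
move=> unb; apply: filter_from_proper => M _.
have [|v Mv] := unb (`|M| + 1); first by rewrite ltr_wpDl.
exists v => /=; apply: lt_le_trans Mv.
by rewrite (le_lt_trans (ler_norm M))// ltrDl.
Qed.

Definition typical o mu := mu v @[v --> len_infty o] --> (0 : R).

Definition wnorm mu f : \bar R :=
  ereal_sup [set (mu v * cmod (f v))%:E | v in [set: T]].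

Definition Linfty mu : set (T -> R[i]) := [set f | (wnorm mu f < +oo)%E].

Definition Lzero o mu : set (T -> R[i]) :=
  [set f | Linfty mu f /\
           mu v * cmod (f v) @[v --> len_infty o] --> (0 : R)].

Definition wcomp psi phi f : T -> R[i] := fun v => psi v * f (phi v).

(* [A] restricts to a bounded linear operator of the subspace [X] of
   [Linfty mu], normed by [wnorm mu], into itself. *)
Definition bounded_operator mu (X : set (T -> R[i]))
    (A : (T -> R[i]) -> (T -> R[i])) :=
  [/\ forall f, X f -> X (A f),
      forall (a : R[i]) f g, X f -> X g ->
        A (fun v => a * f v + g v) = (fun v => a * A f v + A g v)
    & exists C : R, forall f, X f -> (wnorm mu (A f) <= C%:E * wnorm mu f)%E].

End WeightedSpaces.

(* Main.v *)
Require Import Defs.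
From mathcomp Require Import all_boot all_order all_algebra.
From mathcomp Require Import all_classical all_reals all_analysis.
Import Order.TTheory GRing.Theory Num.Theory.
Import numFieldNormedType.Exports.
Local Open Scope classical_set_scope.
Local Open Scope ring_scope.

(** If the operator is bounded, applying it to the constant 1 (which lies in
    [Lzero] because the weight is typical) gives [psi] in [Lzero], and applying
    it to the indicator of [phi v], whose norm is [mu (phi v)], bounds the ratio
    at [v].  Conversely [mu v |psi v f (phi v)|] is the product of the ratio at
    [v] and of [mu (phi v) |f (phi v)|]: it is small when [phi v] is far from
    the root, and when [phi v] stays in a ball, which is finite, it is at most a
    constant times [mu v |psi v|], which tends to 0. *)

Lemma normc_ge0 {R : rcfType} (z : R[i]) : 0 <= cmod z.
Proof. by case: z => a b; exact: sqrtr_ge0. Qed.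

Lemma ereal_sup_EFin_leP {R : realType} {I : Type} (u : I -> R) (b : \bar R) :
  (ereal_sup [set (u i)%:E | i in [set: I]] <= b)%E <->
  forall i, ((u i)%:E <= b)%E.
Proof.
split=> [ub i|ub]; last by apply: ge_ereal_sup => _ [i _ <-].
by apply: le_trans ub; apply: ereal_sup_ubound; exists i.
Qed.

Lemma ereal_sup_EFin_ltyP {R : realType} {I : Type} (u : I -> R) :
  (ereal_sup [set (u i)%:E | i in [set: I]] < +oo)%E <->
  exists B, forall i, u i <= B.
Proof.
split=> [|[B uB]]; last first.
  apply: (@le_lt_trans _ _ B%:E); last by rewrite ltry.
  by apply/ereal_sup_EFin_leP => i; rewrite lee_fin.
have /ereal_sup_EFin_leP := lexx (ereal_sup [set (u i)%:E | i in [set: I]]).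
case: (ereal_sup _) => [B| |] ub //= _.
  by exists B => i; rewrite -lee_fin.
(* A supremum equal to [-oo] would put every [u i] below [-oo], so the index type is empty and any
   bound serves. *)
by exists 0 => i; have := ub i.
Qed.

Lemma finite_set_ubound {R : realDomainType} {T : eqType} (A : set T)
    (u : T -> R) :
  finite_set A -> exists2 B, 0 <= B & forall v, A v -> u v <= B.
Proof.
(* Starting the maximum at 0 makes the bound nonnegative and covers the empty set. *)
move=> /finite_seqP[s ->]; exists (\big[Num.max/0]_(v <- s) u v).
  exact: bigmax_ge_id.
by move=> v vs; apply: le_bigmax_seq.
Qed.

Section VanishingAtInfinity.
Context {R : realType} {T : metricType R}.
Implicit Types (o v : T) (mu u : T -> R) (psi f : T -> R[i]) (phi : T -> T).

Lemma cvg_len_inftyP o u :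
  u v @[v --> len_infty o] --> (0 : R) <->
  forall e, 0 < e -> exists M, forall v, M < len o v -> `|u v| < e.
Proof.
rewrite cvgr0Pnorm_lt; split=> H e /H.
  by case=> M _ Me; exists M.
by case=> M Me; exists M.
Qed.

Lemma locally_finite_ubound o u M : locally_finite o ->
  exists2 B, 0 <= B & forall v, len o v <= M -> u v <= B.
Proof.
(* The radius [|M| + 1] is positive and exceeds [M], so its open ball, finite by [lf], contains the
   closed ball of radius [M]. *)
move=> lf; have M0 : 0 < `|M| + 1 by rewrite ltr_wpDl.
have [B B0 uB] := finite_set_ubound _ u (lf _ M0).
exists B => // v vM; apply: uB => /=.
by rewrite (le_lt_trans vM)// (le_lt_trans (ler_norm M))// ltrDl.
Qed.

Lemma cvg_len_infty_bounded o u : locally_finite o ->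
  u v @[v --> len_infty o] --> (0 : R) -> exists B, forall v, u v <= B.
Proof.
move=> lf /cvg_len_inftyP/(_ 1 ltr01)[M uM].
have [B B0 uB] := locally_finite_ubound o u M lf.
exists (Num.max B 1) => v; rewrite le_max.
have [/uB->//|/uM u1] := leP (len o v) M.
by rewrite (le_trans (ler_norm _) (ltW u1)) orbT.
Qed.

(** The limit alone forces a finite norm: far from the root the weighted modulus is below 1, and
    only finitely many points remain. *)
Lemma LzeroE o mu f : locally_finite o ->
  Lzero o mu f <-> mu v * cmod (f v) @[v --> len_infty o] --> (0 : R).
Proof.
move=> lf; split=> [[]//|f0]; split=> //.
exact/ereal_sup_EFin_ltyP/(cvg_len_infty_bounded o).
Qed.

Definition indic_point w : T -> R[i] := fun v => if v == w then 1 else 0.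

Lemma Lzero_indic_point o mu w : locally_finite o ->
  Lzero o mu (indic_point w).
Proof.
move=> lf; apply/LzeroE => //; apply/cvg_len_inftyP => e e0.
(* Beyond the length of [w] the indicator is identically 0. *)
exists (len o w) => v; rewrite /indic_point.
have [->|_ _] := eqVneq v w; first by rewrite ltxx.
by rewrite ComplexField.Normc.normc0 mulr0 normr0.
Qed.

Lemma wnorm_indic_point mu w : 0 <= mu w ->
  wnorm mu (indic_point w) = (mu w)%:E.
Proof.
move=> mu0; apply/eqP; rewrite eq_le; apply/andP; split.
  apply/ereal_sup_EFin_leP => v; rewrite lee_fin /indic_point.
  have [->|_] := eqVneq v w; first by rewrite ComplexField.Normc.normc1 mulr1.
  by rewrite ComplexField.Normc.normc0 mulr0.
apply: ereal_sup_ubound; exists w => //.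
by rewrite /indic_point eqxx ComplexField.Normc.normc1 mulr1.
Qed.

Lemma wcomp_factor mu psi phi f v : 0 < mu (phi v) ->
  mu v * cmod (wcomp psi phi f v) =
  (mu v / mu (phi v) * cmod (psi v)) * (mu (phi v) * cmod (f (phi v))).
Proof.
move=> m0; rewrite /wcomp ComplexField.Normc.normcM mulrACA.
by rewrite divfK ?gt_eqF// mulrA.
Qed.

Lemma wcomp_Lzero o mu psi phi f (B : R) : locally_finite o ->
  (forall v, 0 < mu v) ->
  (forall v, mu v / mu (phi v) * cmod (psi v) <= B) ->
  Lzero o mu psi -> Lzero o mu f -> Lzero o mu (wcomp psi phi f).
Proof.
move=> lf mu0 psiB /LzeroE psi0 /LzeroE f0; apply/LzeroE => //.
apply/cvg_len_inftyP => e e0.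
have B0 : 0 <= B.
  apply: le_trans (psiB o).
  by rewrite mulr_ge0 ?normc_ge0// divr_ge0 ?ltW.
(* [B] may be 0, so [e] is divided by [B + 1]; likewise by [K + 1] below. *)
have B1 : 0 < B + 1 by rewrite ltr_wpDl.
have /cvg_len_inftyP/(_ _ (divr_gt0 e0 B1))[M fM] := f0 lf.
have [K K0 fK] := locally_finite_ubound o (fun v => cmod (f v)) M lf.
have K1 : 0 < K + 1 by rewrite ltr_wpDl.
have /cvg_len_inftyP/(_ _ (divr_gt0 e0 K1))[N psiN] := psi0 lf.
exists N => v /psiN; rewrite !ger0_norm ?mulr_ge0 ?normc_ge0 ?ltW// => psie.
have [vM|vM] := leP (len o (phi v)) M.
  rewrite /wcomp ComplexField.Normc.normcM mulrA.
  rewrite (@le_lt_trans _ _ (mu v * cmod (psi v) * (K + 1)))//.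
    rewrite ler_wpM2l ?mulr_ge0 ?normc_ge0 ?ltW//.
    by rewrite (le_lt_trans (fK _ vM))// ltrDl.
  by rewrite -ltr_pdivlMr.
rewrite wcomp_factor//.
move/fM: vM; rewrite ger0_norm ?mulr_ge0 ?normc_ge0 ?ltW// => fe.
rewrite (@le_lt_trans _ _ ((B + 1) * (mu (phi v) * cmod (f (phi v)))))//.
  rewrite ler_wpM2r ?mulr_ge0 ?normc_ge0 ?ltW//.
  by rewrite (le_lt_trans (psiB v))// ltrDl.
by rewrite mulrC -ltr_pdivlMr.
Qed.

(** In the factorization at [v], the second factor is a term of the supremum defining the norm of
    [f]. The estimate also covers an infinite norm. *)
Lemma wnorm_wcomp_le mu psi phi f (B : R) : (forall v, 0 < mu v) ->
  (forall v, mu v / mu (phi v) * cmod (psi v) <= B) ->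
  (wnorm mu (wcomp psi phi f) <= B%:E * wnorm mu f)%E.
Proof.
move=> mu0 psiB; apply/ereal_sup_EFin_leP => v.
rewrite wcomp_factor// EFinM lee_pmul ?lee_fin//.
- by rewrite mulr_ge0 ?normc_ge0// divr_ge0 ?ltW.
- by rewrite mulr_ge0 ?normc_ge0 ?ltW.
- by apply: ereal_sup_ubound; exists (phi v).
Qed.

End VanishingAtInfinity.

Theorem theorem3p6 (R : realType) (T : metricType R) (o : T)
    (T_locally_finite : locally_finite o) (T_unbounded : unbounded o)
    (mu : T -> R) (mu_gt0 : forall v, 0 < mu v) (mu_typical : typical o mu)
    (psi : T -> R[i]) (phi : T -> T)
    (phi_infinite_range : infinite_set (range phi)) :
  bounded_operator mu (Lzero o mu) (wcomp psi phi) <->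
  Lzero o mu psi /\
  (ereal_sup [set (mu v / mu (phi v) * cmod (psi v))%:E | v in [set: T]]
     < +oo)%E.
Proof.
split=> [[stable _ [C normC]]|[psi0 /ereal_sup_EFin_ltyP[B psiB]]]; last first.
  split=> [f f0|a f g _ _|]; first exact: wcomp_Lzero psiB psi0 f0.
    by apply/funext => v; rewrite /wcomp mulrDr mulrCA.
  by exists B => f _; apply: wnorm_wcomp_le.
split.
  have -> : psi = wcomp psi phi (fun=> 1).
    by apply/funext => v; rewrite /wcomp mulr1.
  apply/stable/LzeroE => //.
  by under eq_fun do rewrite ComplexField.Normc.normc1 mulr1.
apply/ereal_sup_EFin_ltyP; exists C => v.
have /normC := Lzero_indic_point o mu (phi v) T_locally_finite.
(* The supremum on the left is evaluated at [v], where the indicator of [phi v] composed with [phi]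
   equals 1. *)
rewrite (wnorm_indic_point _ _ (ltW (mu_gt0 _))) -EFinM => /ereal_sup_EFin_leP/(_ v).
rewrite lee_fin /wcomp /indic_point eqxx mulr1 => psiC.
by rewrite mulrAC ler_pdivrMr.
Qed.
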